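(* Let $q\in[-1,1]$ and $f\in\mathcal{H}$. Let $\epsilon_f>0$ be such that the series $T_q(x):=\sum_{n=0}^\infty x^n\langle\Phi,Q(f)^{2n}\Phi\rangle$ converges for all $x\in(-\epsilon_f,\epsilon_f)$, and put $\epsilon:=\min\left\{\frac{1}{4\Vert f\Vert^2},\epsilon_f\right\}$ (with $\frac{1}{4\Vert f\Vert^2}:=+\infty$ if $f=0$). Then $$T_q(x)=\frac{1-q+(1+q)\sqrt{1-4\Vert f\Vert^2x}}{1-q+(1+q)\sqrt{1-4\Vert f\Vert^2x}-2\Vert f\Vert^2x},\qquad\forall x\in(-\epsilon,\epsilon).$$
   Context: $\mathcal{H}$ is a (complex) Hilbert space of dimension at least $2$ with scalar product $\langle\cdot,\cdot\rangle$, and $q\in[-1,1]$. Let $\langle\cdot,\cdot\rangle_{\otimes n}$ be the standard scalar product on $\mathcal{H}^{\otimes n}$. Define operators $\lambda_1:=\mathbf{1}_{\mathcal{H}}$; $\lambda_2$ on $\mathcal{H}^{\otimes2}$, the linear operator with $\lambda_2(f\otimes g)=f\otimes g+q\,g\otimes f$; and $\lambda_{n+2}:=\mathbf{1}_{\mathcal{H}}^{\otimes n}\otimes\lambda_2$ on $\mathcal{H}^{\otimes(n+2)}$ for $n\ge1$. These are positive. For $n\ge1$ let $\mathcal{H}_n$ be the Hilbert space obtained by quotienting $(\mathcal{H}^{\otimes n},\langle\cdot,\lambda_n\cdot\rangle_{\otimes n})$ by the null space and completing; $\mathcal{H}_0:=\mathbb{C}$. The $(\mathbf{q},2)$-Fock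 space is $\Gamma_{q,2}(\mathcal{H}):=\bigoplus_{n\ge0}\mathcal{H}_n$, with vacuum vector $\Phi:=1\oplus0\oplus0\oplus\cdots$. For $f\in\mathcal{H}$ the creation operator $A^+(f)$ is the bounded linear operator with $A^+(f)\Phi:=f$ and $A^+(f)F:=f\otimes F$ for $F\in\mathcal{H}_n$, $n\ge1$; the annihilation operator is its adjoint $A(f):=(A^+(f))^*$. Explicitly, $A(f)\Phi=0$, $A(f)g_1=\langle f,g_1\rangle\Phi$, $A(f)(g_1\otimes g_2)=\langle f,g_1\rangle g_2+q\langle f,g_2\rangle g_1$, and $A(f)(g_1\otimes\cdots\otimes g_n)=\langle f,g_1\rangle g_2\otimes\cdots\otimes g_n$ for $n>2$. The field operator is $Q(f):=A(f)+A^+(f)$, a bounded self-adjoint operator (so such an $\epsilon_f>0$ exists). The function $T_q$ is called the moment-generating function of $Q(f)^2$ with respect to the vacuum state. *)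

(* Defs.v *)
From HB Require Import structures.
From mathcomp Require Import all_boot all_order all_algebra.
From mathcomp Require Import complex.
From mathcomp Require Import all_classical all_reals all_analysis.

Set Implicit Arguments.
Unset Strict Implicit.
Unset Printing Implicit Defensive.

Import Order.TTheory GRing.Theory Num.Theory.
Import numFieldNormedType.Exports.

Local Open Scope classical_set_scope.
Local Open Scope ring_scope.
Local Open Scope complex_scope.

(* A complex Hilbert space: a complete normed space over R[i] whose norm comes
   from a scalar product. *)
HB.mixin Record isHilbert (R : realType) (H : Type)
    of CompleteNormedModule R[i] H := {
  hilbert_dot : {dot H for (@Num.conj R[i])};
  hilbert_dot_norm : forall u : H, hilbert_dot u u = `|u| ^+ 2
}.

#[short(type="hilbertType")]
HB.structure Definition Hilbert (R : realType) :=
  { H of isHilbert R H & CompleteNormedModule R[i] H }.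

(* Forms of type {dot _ for _} are linear on the left; the scalar product used
   here is linear on the right and conjugate-linear on the left. *)
Definition inner (R : realType) (H : hilbertType R) (u v : H) : R[i] :=
  hilbert_dot v u.

(* The norm of a normed space over R[i] takes its values in R[i]. *)
Definition hnorm (R : realType) (H : hilbertType R) (u : H) : R :=
  complex.Re `|u|.

Definition dim_ge2 (R : realType) (H : hilbertType R) : Prop :=
  exists u v : H, forall a b : R[i], a *: u + b *: v = 0 -> a = 0 /\ b = 0.

Definition cspan (R : realType) (H : hilbertType R) (X : set H) : set H :=
  [set v | exists (n : nat) (c : 'I_n -> R[i]) (x : 'I_n -> H),
     (forall i, X (x i)) /\ v = \sum_i c i *: x i].

(* Below, a tensor power, a completed quotient or a direct sum of Hilbert spaces
   is a Hilbert space given together with its structure maps; it is determined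
   up to a unique unitary map compatible with them. *)

(* [T] with [t : (f_1, ..., f_n) |-> f_1 (x) ... (x) f_n] is the n-th Hilbert
   tensor power of [H]. Multilinearity of [t] follows from the formula for the
   scalar products. For n = 0, [T] is the line spanned by the unit vector
   [t [tuple]], i.e. the field of complex numbers with its unit 1. *)
Definition is_tensor_power (R : realType) (H : hilbertType R) (n : nat)
    (T : hilbertType R) (t : n.-tuple H -> T) : Prop :=
  (forall f g : n.-tuple H,
      inner (t f) (t g) = \prod_(i < n) inner (tnth f i) (tnth g i)) /\
  dense (cspan (range t)).

Section Q2Lambda.
Context (R : realType) (H : hilbertType R) (q : R).
Context (T : nat -> hilbertType R) (t : forall n, n.-tuple H -> T n).

(* The third clause is the action of 1 (x) ... (x) 1 (x) lambda_2 on the simple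
   tensors f_1 (x) ... (x) f_n (x) g (x) h; for n = 0 it is lambda_2 itself. *)
Definition is_q2_lambda (lam : forall n, {linear T n -> T n}) : Prop :=
  [/\ forall n, continuous (lam n),
      (forall u, lam 0%N u = u) /\ (forall u, lam 1%N u = u) &
      forall n (s : n.-tuple H) (g h : H),
        lam (n + 2)%N (t (cat_tuple s [tuple g; h])) =
          t (cat_tuple s [tuple g; h]) +
          q%:C *: t (cat_tuple s [tuple h; g])].

End Q2Lambda.

(* [K] is the completion of the quotient of [V], with the semi-definite scalar
   product <u, B v>, by its null space; [j] is the canonical map. *)
Definition is_deformed_completion (R : realType) (V : hilbertType R)
    (B : V -> V) (K : hilbertType R) (j : {linear V -> K}) : Prop :=
  (forall u v : V, inner (j u) (j v) = inner u (B v)) /\ dense (range j).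

Definition is_hilbert_sum (R : realType) (V : nat -> hilbertType R)
    (K : hilbertType R) (i : forall n, {linear V n -> K}) : Prop :=
  [/\ forall n (u v : V n), inner (i n u) (i n v) = inner u v,
      forall m n (u : V m) (v : V n), m <> n -> inner (i m u) (i n v) = 0 &
      dense (cspan (\bigcup_n range (i n)))].

(* The (q,2)-Fock space over [H], with the spaces and maps it is built from.
   [fock_comp 0] is the field of complex numbers, see [is_tensor_power]. *)
Record q2_fock (R : realType) (H : hilbertType R) (q : R) := Q2Fock {
  fock_tensor : nat -> hilbertType R;
  fock_simple : forall n, n.-tuple H -> fock_tensor n;
  fock_simpleP : forall n, is_tensor_power (@fock_simple n);
  fock_lambda : forall n, {linear fock_tensor n -> fock_tensor n};
  fock_lambdaP : is_q2_lambda q fock_simple fock_lambda;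
  fock_comp : nat -> hilbertType R;
  fock_class : forall n, {linear fock_tensor n -> fock_comp n};
  fock_classP :
    forall n, is_deformed_completion (fock_lambda n) (fock_class n);
  fock_space :> hilbertType R;
  fock_inj : forall n, {linear fock_comp n -> fock_space};
  fock_injP : is_hilbert_sum fock_inj
}.

Section FockOperators.
Context (R : realType) (H : hilbertType R) (q : R) (G : q2_fock H q).

(* The vector of [G] represented by f_1 (x) ... (x) f_n. *)
Definition fock_vector n (s : n.-tuple H) : G :=
  fock_inj G n (fock_class G n (fock_simple G s)).

Definition vacuum : G := fock_vector [tuple].

(* [Ap] is the bounded linear operator with [Ap F = f (x) F] for every simple
   tensor [F]; as these are total, this determines [Ap]. For n = 0 the equation
   says that [Ap] maps the vacuum to [f]. *)
Definition is_creation (f : H) (Ap : {linear G -> G}) : Prop :=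
  continuous Ap /\
  forall n (s : n.-tuple H), Ap (fock_vector s) = fock_vector (cons_tuple f s).

Definition field_op (A Ap : {linear G -> G}) (u : G) : G := A u + Ap u.

Definition vacuum_moment (Q : G -> G) (n : nat) : R[i] :=
  inner vacuum (iter n Q vacuum).

(* Partial sums of the moment-generating function of Q^2 in the vacuum state. *)
Definition sq_mgf_series (Q : G -> G) (x : R) : nat -> R[i]^o :=
  series (fun n => x%:C ^+ n * vacuum_moment Q (2 * n) : R[i]^o).

Definition sq_mgf (Q : G -> G) (x : R) : R[i] := limn (sq_mgf_series Q x).

End FockOperators.

Definition is_adjoint (R : realType) (K : hilbertType R)
    (A B : {linear K -> K}) : Prop :=
  forall u v : K, inner (A u) v = inner u (B v).

(* Main.v *)
(** On the vectors f^(x)l the field operator acts as a Jacobi matrix, with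
    off-diagonal coefficients omega_1 = |f|^2, omega_2 = (1 + q) |f|^2 and
    omega_l = |f|^2 for l >= 3; hence the moments are the path weights w(n, 0)
    of [path_weight].  If kappa solves
      kappa_l = x kappa_(l+1) + omega_l kappa_(l-1)   for l >= 1,
    then F(n) = sum_l kappa_l x^((n+l)/2) w(n, l) satisfies
      F(2N) = kappa_0 - (kappa_0 - kappa_1 x) S_N(x),
    where S_N(x) is the N-th partial sum of the moment series.  For the
    geometrically decaying solution kappa, compare with some y > |x| at which
    the partial sums are still bounded: |F(2N)| = O((|x| / y)^N) tends to 0, so
    T_q(x) = kappa_0 / (kappa_0 - kappa_1 x).  In particular the denominator
    cannot vanish inside the domain of convergence. *)

Require Import Defs.
From HB Require Import structures.
From mathcomp Require Import all_boot all_order all_algebra.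
From mathcomp Require Import complex ring lra.
From mathcomp Require Import all_classical all_reals all_analysis.

Set Implicit Arguments.
Unset Strict Implicit.
Unset Printing Implicit Defensive.

Import Order.TTheory GRing.Theory Num.Theory.
Import numFieldNormedType.Exports.

Local Open Scope classical_set_scope.
Local Open Scope ring_scope.
Local Open Scope complex_scope.

(** * Path weights *)

Section Paths.
Context (R : comNzRingType) (om : nat -> R).

(* The (n, l) entry weighs the n-step paths from 0 to l in the naturals: an up
   step has weight 1 and a down step from l to l - 1 has weight [om l]. *)
Fixpoint path_weight (n l : nat) : R :=
  if n is m.+1 then
    (if l is k.+1 then path_weight m k else 0)
      + om l.+1 * path_weight m l.+1
  else (l == 0)%:R.

Lemma path_weight_gt n l : (n < l)%N -> path_weight n l = 0.
Proof.
elim: n l => [|n IHn] [|l] //= ltnl.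
by rewrite !IHn ?mulr0 ?addr0 // ltnW // ltnW.
Qed.

Lemma path_weight_odd n l : odd (n + l) -> path_weight n l = 0.
Proof.
elim: n l => [|n IHn] [|l] //= odd_nl; rewrite !IHn ?mulr0 ?addr0 //.
all: by move: odd_nl; rewrite ?addnS ?addn0 /= ?negbK.
Qed.

Lemma path_weightS n l :
  path_weight n.+1 l = (if l is k.+1 then path_weight n k else 0)
                         + om l.+1 * path_weight n l.+1.
Proof. by []. Qed.

#[local] Arguments path_weight : simpl never.

Lemma iter_path_weight (V : lmodType R) (e : nat -> V) (Q : {linear V -> V}) n :
    Q (e 0) = e 1 -> (forall l, Q (e l.+1) = e l.+2 + om l.+1 *: e l) ->
  iter n Q (e 0) = \sum_(l < n.+1) path_weight n l *: e l.
Proof.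
move=> Qe0 QeS; elim: n => [|n IHn]; first by rewrite big_ord1 scale1r.
rewrite iterS IHn linear_sum /=.
under [RHS]eq_bigr do rewrite path_weightS scalerDl.
rewrite big_split /= [X in _ = X + _]big_ord_recl scale0r add0r.
rewrite [X in _ = _ + X]big_ord_recr [X in _ = _ + (X + _)]big_ord_recr /=.
rewrite (@path_weight_gt n n.+1) // (@path_weight_gt n n.+2) //.
rewrite !mulr0 !scale0r !addr0.
rewrite [LHS]big_ord_recl [X in _ = X + _]big_ord_recl /= !linearZ /= Qe0.
rewrite -addrA -big_split /=; congr (_ + _); apply: eq_bigr => l _.
by rewrite linearZ /= QeS scalerDr scalerA mulrC.
Qed.

(** This is F(n) of the overview. Rounding in [./2] affects only terms with [n + l] odd, whose path
    weight is zero. *)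
Definition weighted_sum (ka : nat -> R) (x : R) (n : nat) : R :=
  \sum_(l < n.+1) ka l * x ^+ (n + l)./2 * path_weight n l.

(** Sort the paths by their last step. The steps leaving a level [l >= 1] reassemble [ka l] by the
    recursion; level 0 has no down step, which leaves the boundary term. *)
Lemma weighted_sumS ka x n :
    (forall l, ka l.+1 = ka l.+2 * x + om l.+1 * ka l) ->
  weighted_sum ka x n.+1 =
    weighted_sum ka x n + (ka 1 * x - ka 0) * x ^+ n./2 * path_weight n 0.
Proof.
move=> kaE; rewrite /weighted_sum.
under eq_bigr do rewrite path_weightS mulrDr.
rewrite big_split /= [X in X + _ = _]big_ord_recl mulr0 add0r.
rewrite [X in _ + X = _]big_ord_recr [X in _ + (X + _) = _]big_ord_recr /=.
rewrite (@path_weight_gt n n.+1) // (@path_weight_gt n n.+2) // !mulr0 !addr0.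
rewrite [X in X + _ = _]big_ord_recl [X in _ = X + _]big_ord_recl /=.
rewrite !addn0 !addn1 /= exprS.
suff -> : \sum_(i < n) ka i.+1 * x ^+ (n + i.+1)./2 * path_weight n i.+1 =
    \sum_(i < n) ka i.+2 * x ^+ (n.+1 + i.+2)./2 * path_weight n i.+1 +
    \sum_(i < n) ka i * x ^+ (n.+1 + i)./2 * (om i.+1 * path_weight n i.+1).
  rewrite /bump /=; under eq_bigr do rewrite !add1n.
  by ring.
rewrite -big_split; apply: eq_bigr => l _ /=.
by rewrite kaE !addnS /= exprS; ring.
Qed.

Lemma weighted_sum_even ka x N :
    (forall l, ka l.+1 = ka l.+2 * x + om l.+1 * ka l) ->
  weighted_sum ka x (2 * N) =
    ka 0 - (ka 0 - ka 1 * x) * \sum_(n < N) x ^+ n * path_weight (2 * n) 0.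
Proof.
move=> kaE; elim: N => [|N IHN].
  by rewrite big_ord0 mulr0 subr0 /weighted_sum big_ord1 expr0 !mulr1.
rewrite mulnS !addSn add0n !weighted_sumS // IHN big_ord_recr /=.
(* The boundary term at an odd time vanishes: no path returns to 0 in an odd number of steps. *)
rewrite [path_weight (2 * N).+1 0]path_weight_odd; last first.
  by rewrite addn0 /= mul2n odd_double.
by rewrite (_ : (2 * N)./2 = N) ?mul2n ?doubleK //; ring.
Qed.

End Paths.

(** The moments live in [R[i]], while the estimates use the order of [R]. *)
Lemma path_weight_rmorph (R S : comNzRingType) (g : {rmorphism R -> S})
    (om : nat -> R) n l :
  path_weight (g \o om) n l = g (path_weight om n l).
Proof.
elim: n l => [|n IHn] [|l] /=; rewrite ?rmorph_nat // rmorphD rmorphM !IHn //.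
by rewrite rmorph0.
Qed.

Lemma path_weight_ge0 (R : realDomainType) (om : nat -> R) n l :
  (forall k, 0 <= om k) -> 0 <= path_weight om n l.
Proof.
move=> om_ge0; elim: n l => [|n IHn] [|l] //=.
  by rewrite add0r mulr_ge0.
by rewrite addr_ge0 ?mulr_ge0.
Qed.

(** Every level carries the factor [x ^+ N], because halving [2 * N + l] gives [N + l./2]. This
    yields the common factor in [N]; the remaining powers compare by [|x| <= y]. *)
Lemma weighted_sum_le (R : realFieldType) (om ka ka' : nat -> R) (B x y : R) N :
    (forall l, 0 <= om l) -> (forall l, `|ka l| <= B * ka' l) ->
    `|x| <= y -> 0 < y ->
  `|weighted_sum om ka x (2 * N)| <=
    B * (`|x| / y) ^+ N * weighted_sum om ka' y (2 * N).
Proof.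
move=> om_ge0 kaB xy y0; rewrite /weighted_sum mulr_sumr.
apply: le_trans (ler_norm_sum _ _ _) _; apply: ler_sum => l _.
rewrite !normrM normrX [`|path_weight _ _ _|]ger0_norm ?path_weight_ge0 //.
rewrite [leRHS]mulrA ler_wpM2r ?path_weight_ge0 //.
have half_even k : ((2 * N + k)./2 = N + k./2)%N.
  by rewrite mul2n halfD odd_double doubleK.
rewrite half_even.
rewrite !exprD expr_div_n.
rewrite (_ : B * _ * _ = B * ka' l * (`|x| ^+ N * y ^+ l./2)); last first.
  by field; rewrite expf_neq0 ?gt_eqF.
apply: ler_pM; rewrite ?mulr_ge0 ?exprn_ge0 ?ler_wpM2l //.
by apply: lerXn2r; rewrite ?nnegrE // ltW.
Qed.

(** * The explicit decaying solution kappa *)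

Section Q2Coefficients.
Context (R : rcfType) (q c : R).

(* [q2_omega 0] is irrelevant. *)
Definition q2_omega (l : nat) : R :=
  match l with 0 => 0 | 2 => (1 + q) * c | _ => c end.

(* The ratio 2 c / (1 + s) is c C(c x), with C the generating function of the
   Catalan numbers: it is the root r of r = r^2 x + c regular at x = 0. *)
Definition q2_kappa (x : R) (l : nat) : R :=
  let s := Num.sqrt (1 - 4 * c * x) in
  match l with
  | 0 => (1 - q + (1 + q) * s) / 2
  | 1 => c
  | k.+2 => (1 + q) * c * (2 * c / (1 + s)) ^+ k.+1
  end.

(** For [l >= 1] this is a multiple of the root equation r = r^2 x + c; kappa_0 is chosen so that
    the case [l = 0] holds. *)
Lemma q2_kappaE x l : 4 * c * x <= 1 ->
  q2_kappa x l.+1 = q2_kappa x l.+2 * x + q2_omega l.+1 * q2_kappa x l.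
Proof.
move=> cx1; rewrite /q2_kappa; set s := Num.sqrt _.
have s_ge0 : 0 <= s by exact: sqrtr_ge0.
have sE : s ^+ 2 = 1 - 4 * c * x by rewrite sqr_sqrtr ?subr_ge0.
have cE : 4 * c * x = 1 - s ^+ 2 by rewrite sE; ring.
have s1 : 1 + s != 0 by rewrite gt_eqF // ltr_pwDl.
have step : 2 * c / (1 + s) = (2 * c / (1 + s)) ^+ 2 * x + c.
  (* Collecting [x] in [4 * c * x] lets [cE] eliminate it, leaving a rational identity in [c] and
     [s]. *)
  have -> : (2 * c / (1 + s)) ^+ 2 * x = 4 * c * x * (c / (1 + s) ^+ 2).
    by field.
  by rewrite cE; field.
case: l => [|[|l]] /=.
- have -> : (1 + q) * c * (2 * c / (1 + s)) ^+ 1 * x =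
      4 * c * x * ((1 + q) * c / (2 * (1 + s))) by field.
  by rewrite cE; field.
- rewrite expr1 [X in _ * X = _]step; ring.
- rewrite !exprS; move: (_ ^+ l) => p.
  move: step; move: (_ / _) => a step.
  by rewrite [X in (1 + q) * c * (X * _) = _]step; ring.
Qed.

End Q2Coefficients.

(** * Positivity and comparison of kappa at two points *)

Section Q2Bounds.
Context (R : rcfType) (q c : R).
Hypotheses (hq : -1 <= q <= 1) (c_ge0 : 0 <= c).

Let q_ge : 0 <= 1 + q.
Proof. by case/andP: hq => *; lra. Qed.

Let q_le : q <= 1.
Proof. by case/andP: hq. Qed.

Lemma q2_omega_ge0 l : 0 <= q2_omega q c l.
Proof. by case: l => [|[|[|l]]] //=; exact: mulr_ge0. Qed.

(** Both summands are nonnegative. The first is positive for q < 1; at q = 1 the second is, since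
    the strict hypothesis makes the root positive. *)
Lemma q2_kappa0_gt0 x : 4 * c * x < 1 -> 0 < q2_kappa q c x 0.
Proof.
rewrite -subr_gt0 -[0 < 1 - _]sqrtr_gt0 /q2_kappa.
move: (Num.sqrt _) => s s_gt0; rewrite divr_gt0 //.
have [q1|q1] := ltP q 1.
  by rewrite ltr_pwDl ?subr_gt0 // mulr_ge0 // ltW.
by rewrite ltr_wpDl ?subr_ge0 // mulr_gt0 //
  (lt_le_trans _ (lerD (lexx 1) q1)) // addr_gt0.
Qed.

(** For [l >= 1], kappa_l is nondecreasing in x and the summand 1 of the constant suffices. At level
    0 it is nonincreasing, whence the ratio. *)
Lemma q2_kappa_le x y l : x <= y -> 4 * c * y < 1 ->
  `|q2_kappa q c x l| <=
    (1 + q2_kappa q c x 0 / q2_kappa q c y 0) * q2_kappa q c y l.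
Proof.
move=> xy cy.
have cx : 4 * c * x < 1 by apply: le_lt_trans cy; rewrite ler_wpM2l // mulr_ge0.
have kx := q2_kappa0_gt0 cx; have ky := q2_kappa0_gt0 cy.
have kxy : 0 <= q2_kappa q c x 0 / q2_kappa q c y 0 by rewrite divr_ge0 ?ltW.
case: l => [|[|l]].
- rewrite gtr0_norm // mulrDl mul1r divfK ?gt_eqF //.
  by rewrite lerDr ltW.
- by rewrite /= ger0_norm // mulrDl mul1r lerDl mulr_ge0.
set sx := Num.sqrt (1 - 4 * c * x); set sy := Num.sqrt (1 - 4 * c * y).
have sy_ge0 : 0 <= sy by exact: sqrtr_ge0.
have sxy : sy <= sx by rewrite ler_wsqrtr // lerB // ler_wpM2l // mulr_ge0.
have le_k : (1 + q) * c * (2 * c / (1 + sx)) ^+ l.+1 <=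
            (1 + q) * c * (2 * c / (1 + sy)) ^+ l.+1.
  rewrite ler_wpM2l ?mulr_ge0 // lerXn2r ?nnegrE ?divr_ge0 ?mulr_ge0 //.
  - by rewrite addr_ge0 // (le_trans sy_ge0).
  - by rewrite addr_ge0.
  rewrite ler_wpM2l ?mulr_ge0 // lef_pV2 ?posrE ?lerD2l //.
    by rewrite ltr_pwDl // (le_trans sy_ge0).
  by rewrite ltr_pwDl.
rewrite [q2_kappa q c x l.+2]/= [q2_kappa q c y l.+2]/= -/sx -/sy.
have kx_ge0 : 0 <= (1 + q) * c * (2 * c / (1 + sx)) ^+ l.+1.
  rewrite mulr_ge0 ?exprn_ge0 ?divr_ge0 ?mulr_ge0 //.
  by rewrite addr_ge0 // (le_trans sy_ge0).
rewrite ger0_norm //; apply: (le_trans le_k).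
by rewrite ler_peMl ?lerDl // (le_trans kx_ge0).
Qed.

Lemma q2_partial_sum_bound x y M : `|x| < y -> 4 * c * y < 1 ->
    (forall N, `|\sum_(n < N) y ^+ n * path_weight (q2_omega q c) (2 * n) 0|
                 <= M) ->
  exists K, forall N,
    `|q2_kappa q c x 0 - (q2_kappa q c x 0 - c * x) *
        \sum_(n < N) x ^+ n * path_weight (q2_omega q c) (2 * n) 0|
      <= K * (`|x| / y) ^+ N.
Proof.
move=> xy cy yM; have y_gt0 : 0 < y := le_lt_trans (normr_ge0 x) xy.
have xy' : x <= y := le_trans (ler_norm x) (ltW xy).
have cx : 4 * c * x < 1 by apply: le_lt_trans cy; rewrite ler_wpM2l // mulr_ge0.
pose B := 1 + q2_kappa q c x 0 / q2_kappa q c y 0.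
have B_ge0 : 0 <= B.
  by rewrite addr_ge0 // divr_ge0 // ltW // q2_kappa0_gt0.
(* The factor after [B] bounds F(2N) at [y], by [weighted_sum_even] and the bound [M]. *)
exists (B * (q2_kappa q c y 0 + `|q2_kappa q c y 0 - c * y| * M)) => N.
rewrite -(@weighted_sum_even _ _ (q2_kappa q c x)); last first.
  by move=> l; apply: q2_kappaE; exact: ltW.
apply: (@le_trans _ _ (B * (`|x| / y) ^+ N *
                       weighted_sum (q2_omega q c) (q2_kappa q c y) y (2 * N))).
  apply: weighted_sum_le => //; [exact: q2_omega_ge0| |exact: ltW].
  by move=> l; exact: q2_kappa_le.
rewrite weighted_sum_even; last first.
  by move=> l; apply: q2_kappaE; exact: ltW.
rewrite -!mulrA ler_wpM2l // mulrC.
rewrite ler_wpM2r ?exprn_ge0 ?divr_ge0 ?(ltW y_gt0) //.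
rewrite lerD2l; apply: le_trans (ler_norm _) _.
by rewrite normrN normrM ler_wpM2l.
Qed.

End Q2Bounds.

(** * Hilbert spaces *)

Section Inner.
Context (R : realType) (V : hilbertType R).
Implicit Types u v w : V.

Lemma innerDr u v w : inner u (v + w) = inner u v + inner u w.
Proof. by rewrite /inner linearDl. Qed.

Lemma innerBr u v w : inner u (v - w) = inner u v - inner u w.
Proof. by rewrite /inner linearBl. Qed.

Lemma innerZr (a : R[i]) u v : inner u (a *: v) = a * inner u v.
Proof. by rewrite /inner linearZl_LR. Qed.

Lemma inner0r u : inner u 0 = 0.
Proof. by rewrite /inner linear0l. Qed.

Lemma inner_sumr u n (F : 'I_n -> V) :
  inner u (\sum_i F i) = \sum_i inner u (F i).
Proof.
by apply: (big_morph _ (id1 := 0) (op1 := +%R)) => [v w|];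
  [exact: innerDr | exact: inner0r].
Qed.

Lemma innerC u v : inner u v = Num.conj (inner v u).
Proof. by rewrite /inner hermC /= mul1r. Qed.

Lemma innerBl u v w : inner (u - v) w = inner u w - inner v w.
Proof. by rewrite /inner linearBr. Qed.

Lemma conjC_real (a : R) : Num.conj (a%:C : R[i]) = a%:C.
Proof. exact: conjc_real. Qed.

Lemma innerZl (a : R) u v : inner (a%:C *: u) v = a%:C * inner u v.
Proof. by rewrite innerC innerZr rmorphM /= -innerC [Num.conj _]conjC_real. Qed.

Lemma inner_norm u : inner u u = `|u| ^+ 2.
Proof. exact: hilbert_dot_norm. Qed.

Lemma inner_hnorm u : inner u u = (hnorm u ^+ 2)%:C.
Proof. by rewrite inner_norm /hnorm rmorphXn /= RRe_real ?normr_real. Qed.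

Lemma inner_le_norm u v : `|inner u v| <= `|u| * `|v|.
Proof.
have [->|v0] := eqVneq v 0; first by rewrite inner0r !normr0 mulr0.
rewrite -ler_sqr ?nnegrE ?mulr_ge0 // exprMn.
have nv : 0 < `|v| ^+ 2 by rewrite exprn_gt0 ?normr_gt0.
rewrite -subr_ge0 -(pmulr_rge0 _ nv).
have nvE : `|v| ^+ 2 = (hnorm v ^+ 2)%:C by rewrite -inner_norm inner_hnorm.
(* Cauchy-Schwarz: [w] is |v|^2 times the component of [u] orthogonal to [v]. *)
pose w := (hnorm v ^+ 2)%:C *: u - inner v u *: v.
have : 0 <= inner w w by rewrite inner_norm exprn_ge0.
rewrite innerBr !innerZr !innerBl !innerZl.
rewrite [inner (_ *: v) u]innerC [inner (_ *: v) v]innerC !innerZr !rmorphM /=.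
rewrite -!innerC !inner_norm normCK -innerC nvE => /le_trans; apply.
by rewrite le_eqVlt; apply/orP; left; apply/eqP; ring.
Qed.

Lemma inner_continuous u : continuous (inner u : V -> R[i]^o).
Proof.
move=> v; apply/(@cvgrPdist_lt _ R[i]^o) => e e0.
have d0 : 0 < `|u| + 1 by rewrite ltr_wpDl.
have : \forall w \near v, `|v - w| < e / (`|u| + 1).
  by apply: (@cvgr_dist_lt _ V); [exact: cvg_id | rewrite divr_gt0].
apply: filterS => w vw; rewrite -innerBr.
apply: le_lt_trans (inner_le_norm _ _) _.
rewrite ltr_pdivlMr // in vw; apply: le_lt_trans vw.
by rewrite mulrC ler_wpM2l // lerDl.
Qed.

(** By Pythagoras |u - v|^2 = |u|^2 + |v|^2 for [v] in [S], so [S] misses the ball of radius |u|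
    around [u]. *)
Lemma dense_orthogonal_eq0 (S : set V) u :
  dense S -> (forall v, S v -> inner u v = 0) -> u = 0.
Proof.
move=> dS uS; apply/eqP; apply: contraT => u0.
have nu : 0 < `|u| by rewrite normr_gt0.
have [] := dS (ball u `|u|); first by exists u; exact: ballxx.
  exact: ball_open.
move=> v [] /=; rewrite -ball_normE /= => uv Sv.
suff : `|u| ^+ 2 <= `|u - v| ^+ 2.
  by rewrite ler_sqr ?nnegrE // => /(lt_le_trans uv); rewrite ltxx.
rewrite -!inner_norm innerBr !innerBl [inner v u]innerC !(uS v) // conjC0.
by rewrite subr0 sub0r opprK lerDl inner_norm exprn_ge0.
Qed.

End Inner.

(** By Cauchy-Schwarz |phi v|^2 <= |v| |B v|. This serves the quotient maps with [B] = lambda and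
    the injections with [B] the identity. *)
Lemma form_continuous (R : realType) (V W : hilbertType R) (B : {linear V -> V})
    (phi : {linear V -> W}) :
  continuous B -> (forall u v, inner (phi u) (phi v) = inner u (B v)) ->
  continuous phi.
Proof.
move=> cB phiE v; apply/cvgrPdist_lt => e e0.
have Bv : \forall w \near v, `|B v - B w| < e.
  by apply: cvgr_dist_lt => //; exact: cB.
have vv : \forall w \near v, `|v - w| < e.
  by apply: (@cvgr_dist_lt _ V) => //; exact: cvg_id.
apply: filterS2 vv Bv => w vw Bvw.
rewrite -linearB /= -ltr_sqr ?nnegrE ?(ltW e0) //.
rewrite -inner_norm phiE.
have /ger0_norm <- : 0 <= inner (v - w) (B (v - w)).
  by rewrite -phiE inner_norm exprn_ge0.
apply: le_lt_trans (inner_le_norm _ _) _; rewrite linearB expr2.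
by apply: ltr_pM.
Qed.

Lemma dense_orthogonal_comp (R : realType) (V W : hilbertType R) (S : set V)
    (phi : {linear V -> W}) (u : W) :
  dense S -> continuous phi -> (forall v, S v -> inner u (phi v) = 0) ->
  forall v, inner u (phi v) = 0.
Proof.
move=> dS cphi uS v; apply/eqP; apply: contraT => uv.
have [] := dS ((fun w => inner u (phi w) : R[i]^o) @^-1` [set~ 0]).
- by exists v; apply/eqP.
- apply: open_comp => [w _|]; last first.
    apply/closed_openC/accessible_closed_set1/hausdorff_accessible.
    exact: (@norm_hausdorff _ R[i]^o).
  apply: (@continuous_comp _ _ _ phi (inner u : W -> R[i]^o)).
    exact: cphi.
  exact: inner_continuous.
- by move=> w [] /= + /uS.
Qed.

Lemma cspan_orthogonal (R : realType) (V W : hilbertType R) (X : set V)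
    (phi : {linear V -> W}) (u : W) :
  (forall v, X v -> inner u (phi v) = 0) ->
  forall v, cspan X v -> inner u (phi v) = 0.
Proof.
move=> uX v [n [c [x [Xx ->]]]]; rewrite linear_sum inner_sumr big1 // => i _.
by rewrite linearZ /= innerZr uX // mulr0.
Qed.

(** * The Fock space *)

(** Sequences instead of tuples allow splitting at either end without casts between lengths. *)
Definition prod_inner (R : realType) (H : hilbertType R) (a b : seq H) : R[i] :=
  \prod_(p <- zip a b) inner p.1 p.2.

Section Fock.
Context (R : realType) (H : hilbertType R) (q : R) (G : q2_fock H q).
Local Notation lam := (fock_lambda G _).

Lemma prod_inner_cons (a b : H) s s' :
  prod_inner (a :: s) (b :: s') = inner a b * prod_inner s s'.
Proof. by rewrite /prod_inner /= big_cons. Qed.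

Lemma inner_fock_simple n (a b : n.-tuple H) :
  inner (fock_simple G a) (fock_simple G b) = prod_inner a b.
Proof.
case: (fock_simpleP G n) => -> _; rewrite /prod_inner.
rewrite (big_tuple _ _ (zip_tuple a b)) /=; apply: eq_bigr => i _.
by rewrite !(tnth_nth (tnth a i, tnth b i)) /= nth_zip ?size_tuple //=
  -!tnth_nth.
Qed.

Lemma inner_fock_vector n (a b : n.-tuple H) :
  inner (fock_vector G a) (fock_vector G b) =
  inner (fock_simple G a) (lam (fock_simple G b)).
Proof.
case: (fock_injP G) => -> _ _; case: (fock_classP G n) => -> _ //.
Qed.

Lemma inner_fock_vector_neq m n (a : m.-tuple H) (b : n.-tuple H) :
  m <> n -> inner (fock_vector G a) (fock_vector G b) = 0.
Proof. by case: (fock_injP G) => _ /(_ m n) orth _ mn; exact: orth. Qed.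

Lemma inner_fock_lambda n (a b : n.-tuple H) s g h :
  val b = s ++ [:: g; h] ->
  inner (fock_simple G a) (lam (fock_simple G b)) =
    prod_inner a (s ++ [:: g; h]) + q%:C * prod_inner a (s ++ [:: h; g]).
Proof.
move=> bE; have nE : n = (size s + 2)%N by rewrite -(size_tuple b) bE size_cat.
case: (fock_lambdaP G) => _ _ lamE.
subst n.
rewrite (_ : b = cat_tuple (in_tuple s) [tuple g; h]); last exact: val_inj.
by rewrite lamE innerDr innerZr !inner_fock_simple.
Qed.

(** Orthogonality spreads by density and continuity through the three stages: tensor power,
    completed quotient, direct sum. *)
Lemma fock_vector_total (u : G) :
  (forall n (s : n.-tuple H), inner u (fock_vector G s) = 0) -> u = 0.
Proof.
move=> u0; have [injE _ dinj] := fock_injP G.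
have u1 n v : inner u (fock_inj G n v) = 0.
  have cinj : continuous (fock_inj G n).
    by apply: (@form_continuous _ _ _ idfun) => [w|*];
      [exact: cvg_id|exact: injE].
  have [classE dclass] := fock_classP G n; have [_ dsimple] := fock_simpleP G n.
  apply: (dense_orthogonal_comp dclass cinj _ v) => _ [w _ <-].
  pose phi := (fock_inj G n \o fock_class G n : {linear _ -> _}).
  apply: (@dense_orthogonal_comp _ _ _ _ phi u dsimple).
    move=> x; apply: continuous_comp; last exact: cinj.
    by apply: (form_continuous _ classE); case: (fock_lambdaP G).
  by apply: cspan_orthogonal => _ [s _ <-]; exact: u0.
apply: (dense_orthogonal_eq0 dinj).
by apply: (@cspan_orthogonal _ _ _ _ idfun) => _ [n _ [v _ <-]]; exact: u1.
Qed.

(** * The field operator on the tensor powers of f *)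

Section OneParticle.
Context (f : H).
Let c := hnorm f ^+ 2.

Definition fock_power l : G := fock_vector G (nseq_tuple l f).

Lemma vacuum_fock_power : vacuum G = fock_power 0.
Proof. by congr (fock_vector G _); exact: val_inj. Qed.

Lemma inner_vacuum_fock_power l : inner (vacuum G) (fock_power l) = (l == 0)%:R.
Proof.
rewrite vacuum_fock_power; case: l => [|l]; last exact: inner_fock_vector_neq.
rewrite inner_fock_vector; case: (fock_lambdaP G) => _ [-> _] _.
by rewrite inner_fock_simple /prod_inner big_nil.
Qed.

(** Source of the Jacobi coefficients. In degree at least 3, lambda leaves the first factor alone
    and |f|^2 splits off; in degree 2 the swap contributes the extra q; in degree 1 lambda is the
    identity. *)
Lemma inner_fock_power_cons l n (s : n.-tuple H) :
  inner (fock_power l) (fock_vector G (cons_tuple f s)) =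
    if l is k.+1 then
      (q2_omega q c l)%:C * inner (fock_power k) (fock_vector G s)
    else 0.
Proof.
case: l => [|l]; first exact: inner_fock_vector_neq.
have [ln|ln] := eqVneq l n; last first.
  rewrite !inner_fock_vector_neq ?mulr0 //; first exact/eqP.
  by move=> [/eqP]; exact/negP.
subst n; rewrite !inner_fock_vector.
case: l s => [|[|l]] s; last first.
- have [s' [g [h sE]]] : exists s' g h, val s = s' ++ [:: g; h].
    case: s => s /= /eqP; case/lastP: s => // s h; case/lastP: s => // s g _.
    by exists s, g, h; rewrite -!cats1 -catA.
  rewrite (inner_fock_lambda _ sE) (@inner_fock_lambda _ _ _ (f :: s') g h).
    by rewrite /= !prod_inner_cons inner_hnorm /c; ring.
  by rewrite /= sE.
- case: (fock_lambdaP G) => _ [_ ->] _; rewrite inner_fock_simple.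
  have [g sE] : exists g, val s = [:: g].
    by case: s => [[|g []]] //= _; exists g.
  rewrite (@inner_fock_lambda _ _ _ [::] f g) /= sE //.
  have -> : (q2_omega q c 2)%:C = (1 + q%:C) * c%:C.
    by rewrite rmorphM rmorphD rmorph1.
  rewrite !prod_inner_cons inner_hnorm -/c.
  by rewrite /prod_inner big_nil /=; ring.
- case: (fock_lambdaP G) => _ [-> ->] _; rewrite !inner_fock_simple.
  by rewrite tuple0 /= prod_inner_cons inner_hnorm.
Qed.

Context (Ap A : {linear G -> G}).
Hypotheses (hAp : is_creation f Ap) (hA : is_adjoint A Ap).

Lemma creation_fock_power l : Ap (fock_power l) = fock_power l.+1.
Proof. by rewrite (hAp.2); congr (fock_vector G _); exact: val_inj. Qed.

(** Adjointness turns a test against a simple tensor into [inner_fock_power_cons]; such tests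
    determine the vector. *)
Lemma annihilation_fock_power l :
  A (fock_power l) =
    if l is k.+1 then (q2_omega q c l)%:C *: fock_power k else 0.
Proof.
apply/eqP; rewrite -subr_eq0; apply/eqP/fock_vector_total => n s.
rewrite innerBl hA hAp.2 inner_fock_power_cons.
case: l => [|k]; first by rewrite sub0r innerC inner0r conjC0 oppr0.
by rewrite innerZl subrr.
Qed.

Lemma vacuum_moment_path n :
  vacuum_moment (field_op A Ap) n = (path_weight (q2_omega q c) n 0)%:C.
Proof.
pose Q := (A \+ Ap : {linear G -> G}).
have QE m : iter m (field_op A Ap) (vacuum G) = iter m Q (fock_power 0).
  by rewrite vacuum_fock_power.
pose om l := (q2_omega q c l)%:C.
rewrite /vacuum_moment QE (@iter_path_weight _ om).
- rewrite inner_sumr big_ord_recl innerZr inner_vacuum_fock_power mulr1.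
  rewrite big1 ?addr0 => [|l _]; last first.
    by rewrite innerZr inner_vacuum_fock_power mulr0.
  exact: (path_weight_rmorph (real_complex R)).
- by rewrite /= annihilation_fock_power creation_fock_power add0r.
- by move=> l; rewrite /= annihilation_fock_power creation_fock_power addrC.
Qed.

End OneParticle.
End Fock.

(** * Identification of the limit *)

Lemma norm_realC (R : rcfType) (a : R) : `|a%:C : R[i]| = `|a|%:C.
Proof. by rewrite normc_def /= expr0n addr0 sqrtr_sqr. Qed.

Theorem theorem2p8 (R : realType) (H : hilbertType R) (dimH : dim_ge2 H)
    (q : R) (hq : -1 <= q <= 1) (G : q2_fock H q) (f : H)
    (Ap A : {linear G -> G}) (hAp : is_creation f Ap) (hA : is_adjoint A Ap)
    (eps_f : R) (heps_f : 0 < eps_f)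
    (hcv : forall x : R, - eps_f < x < eps_f ->
       cvgn (sq_mgf_series (field_op A Ap) x)) :
  let eps : \bar R :=
    mine (if f == 0 then +oo%E else (1 / (4 * hnorm f ^+ 2))%:E) eps_f%:E in
  forall x : R, (- eps < x%:E)%E -> (x%:E < eps)%E ->
  sq_mgf (field_op A Ap) x =
    ((1 - q + (1 + q) * Num.sqrt (1 - 4 * hnorm f ^+ 2 * x)) /
     (1 - q + (1 + q) * Num.sqrt (1 - 4 * hnorm f ^+ 2 * x)
      - 2 * hnorm f ^+ 2 * x))%:C.
Proof.
move=> eps x ltx xlt; pose c := hnorm f ^+ 2.
have c_ge0 : 0 <= c by rewrite sqr_ge0 // /hnorm.
have xeps : (`|x|%:E < eps)%E.
  have [x0|x0] := leP 0 x; first by rewrite ger0_norm.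
  by rewrite ltr0_norm // EFinN lteNl.
have [xc xf] : 4 * c * `|x| < 1 /\ `|x| < eps_f.
  move: xeps; rewrite /eps lt_min lte_fin => /andP[xc ->]; split=> //.
  (* A nonzero [c] forces [f != 0], so [eps] takes its finite branch. *)
  have [c0|c_neq0] := eqVneq c 0; first by rewrite c0 mulr0 mul0r.
  move: xc; rewrite ifF => [|]; last first.
    by apply: contra_neqF c_neq0 => /eqP f0; rewrite /c f0 /hnorm normr0 expr0n.
  rewrite lte_fin ltr_pdivlMr; first by rewrite mulrC.
  by rewrite mulr_gt0 // lt_def c_neq0.
have [y [xy cy yf]] : exists y, [/\ `|x| < y, 4 * c * y < 1 & y < eps_f].
  have c1 : 0 < 4 * c + 1 by rewrite ltr_wpDl // mulr_ge0.
  (* The [+ 1] keeps the denominator positive at [c = 0] and makes [4 * c * y < 1] strict. *)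
  pose d := Num.min ((eps_f - `|x|) / 2) ((1 - 4 * c * `|x|) / (4 * c + 1)).
  have d0 : 0 < d by rewrite lt_min !divr_gt0 // subr_gt0.
  have d1 : d <= (eps_f - `|x|) / 2 by rewrite ge_min lexx.
  have d2 : d <= (1 - 4 * c * `|x|) / (4 * c + 1) by rewrite ge_min lexx orbT.
  rewrite ler_pdivlMr // in d2.
  exists (`|x| + d); split; [by rewrite ltrDl| |by lra].
  by rewrite mulrDr; lra.
pose S z N := \sum_(n < N) z ^+ n * path_weight (q2_omega q c) (2 * n) 0.
have SE z : sq_mgf_series (field_op A Ap) z = fun N => (S z N)%:C.
  apply/funext => N; rewrite /sq_mgf_series /series /= big_mkord rmorph_sum.
  apply: eq_bigr => n _.
  by rewrite (vacuum_moment_path hAp hA) rmorphM rmorphXn.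
have y_gt0 : 0 < y := le_lt_trans (normr_ge0 x) xy.
have [M yM] : exists M, forall N, `|S y N| <= M.
  have : cvgn (sq_mgf_series (field_op A Ap) y).
    by apply: hcv; rewrite yf andbT (lt_trans _ y_gt0) // oppr_lt0.
  move=> /cvg_seq_bounded [M [Mreal SM]].
  (* Bounds are given only strictly above [M], hence [M + 1], a real element of [R[i]]. *)
  have M1 : M + 1 = (complex.Re (M + 1))%:C by rewrite RRe_real // realD.
  exists (complex.Re (M + 1)) => N; rewrite -lecR -M1 -norm_realC.
  by have := SM (M + 1) _ N I; rewrite SE; apply; rewrite ltrDl.
have [K xK] := q2_partial_sum_bound hq c_ge0 xy cy yM.
have cvS : sq_mgf_series (field_op A Ap) x @ \oo -->
    (sq_mgf (field_op A Ap) x : R[i]^o).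
  by apply: hcv; rewrite -ltr_norml.
set k0 := q2_kappa q c x 0 in xK.
(* The product form is needed first: with [k0 > 0] it then shows that [k0 - c * x] is nonzero. *)
have TE : k0%:C = (k0 - c * x)%:C * sq_mgf (field_op A Ap) x.
  have xy1 : `| `|x| / y | < 1.
    by rewrite normrM normr_id normfV (gtr0_norm y_gt0) ltr_pdivrMr // mul1r.
  pose u N : R[i]^o := (k0 - c * x)%:C * sq_mgf_series (field_op A Ap) x N.
  have uk : u @ \oo --> (k0%:C : R[i]^o).
    apply/(@cvgrPdist_lt _ R[i]^o) => e e0.
    have eE : e = (complex.Re e)%:C by rewrite RRe_real // gtr0_real.
    have e0' : 0 < complex.Re e by rewrite -ltcR -eE.
    have := cvg_geometric K xy1 => /cvgrPdist_lt/(_ _ e0').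
    apply: filterS => N; rewrite sub0r normrN /= => KN.
    rewrite /u SE -rmorphM -rmorphB norm_realC eE ltcR.
    apply: le_lt_trans (xK N) _; exact: le_lt_trans (ler_norm _) KN.
  have uT : u @ \oo -->
      ((k0 - c * x)%:C * sq_mgf (field_op A Ap) x : R[i]^o).
    exact: (@cvgZ _ R[i]^o _ _ _ _ _ _ _ (@cvg_cst R[i]^o _ _ _ _) cvS).
  exact: (cvg_unique (@norm_hausdorff _ R[i]^o) uk uT).
have k0_gt0 : 0 < k0.
  apply: q2_kappa0_gt0 => //; apply: le_lt_trans xc.
  by apply: ler_wpM2l (ler_norm x); rewrite mulr_ge0.
have d_neq0 : k0 - c * x != 0.
  apply: contraTneq k0_gt0 => d0; rewrite d0 mul0r in TE.
  by case: TE => ->; rewrite ltxx.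
have dC_neq0 : (k0 - c * x)%:C != 0 :> R[i].
  by apply: contra_neq d_neq0 => -[].
have -> : sq_mgf (field_op A Ap) x = (k0 / (k0 - c * x))%:C.
  by rewrite rmorphM /= fmorphV TE mulrC mulKf.
congr (_ %:C); rewrite /k0 /= -/c; set n0 := 1 - q + _.
(* [k0] is half the stated numerator, so a factor 1/2 cancels. *)
have -> : n0 / 2 - c * x = (n0 - 2 * c * x) / 2 by field.
by rewrite invf_div mulrA divfK.
Qed.
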